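(* Any random field is restored by its Palm distribution. That is, if $P$ and $P'$ are (positive) random fields whose Palm distributions $Q^{\Pi}_P=\{Q_V^z\}$ and $Q^{\Pi}_{P'}=\{Q_V'^{z}\}$ coincide, i.e. $Q_V^z(x)=Q_V'^{z}(x)$ for all $V\in W$, $t\in\mathbb{Z}^d\setminus V$, $z\in X^t$, $x\in X^V$, then $P=P'$.
   Context: $X\subset\mathbb{R}$ is a finite set with $1<|X|<\infty$, and $d\ge 1$. For $S\subset\mathbb{Z}^d$, $W(S)$ is the set of all finite subsets of $S$, and $W=W(\mathbb{Z}^d)$. $X^S$ is the set of configurations on $S$ (functions $S\to X$). Braces are omitted for one-point sets, e.g. $X^t=X^{\{t\}}$. For disjoint $S,T$ and $x\in X^S$, $y\in X^T$, $xy\in X^{S\cup T}$ is the concatenation. A random field is a probability measure $P$ on $X^{\mathbb{Z}^d}$ with the $\sigma$-algebra generated by cylinder sets; $P_V$ denotes its marginal on $X^V$, $V\in W$. All random fields are assumed positive: $P_V(x)>0$ for all $V\in W$, $x\in X^V$. The Palm distribution of $P$ is the system $Q^{\Pi}_P=\{Q_V^z, z\in X^t, t\in\mathbb{Z}^d\setminus V, V\in W\}$, where $Q_V^z(x)=P_{V\cup\{t\}}(xz)/P_{\{t\}}(z)$, $x\in X^V$, $z\in X^t$. *)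

(* Defs.v *)
From HB Require Import structures.
From mathcomp Require Import all_boot all_order all_algebra finmap.
From mathcomp Require Import all_classical all_reals all_analysis.
Set Implicit Arguments.
Unset Strict Implicit.
Unset Printing Implicit Defensive.
Import Order.TTheory GRing.Theory Num.Theory.

#[local] Open Scope classical_set_scope.
#[local] Open Scope fset_scope.
#[local] Open Scope ring_scope.

Record state_space (R : realType) := StateSpace {
  states :> {fset R};
  states_gt1 : (1 < #|` states|)%N }.

Lemma state_exists (R : realType) (X : state_space R) : exists x : X, true.
Proof.
have : (0 < #|` X|)%N by rewrite (leq_trans _ (states_gt1 X)).
by rewrite cardfs_gt0 => /fset0Pn[x xX]; exists [` xX].
Qed.

(* [measurableType] requires a pointed carrier; the point itself is irrelevant. *)
HB.instance Definition _ (R : realType) (X : state_space R) :=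
  isPointed.Build (fset_sub_type (states X)) (xchoose (state_exists X)).

Section random_fields.
Context {R : realType} {d : nat} {X : state_space R}.
Implicit Types V S T : {fset 'rV[int]_d}.

(* Configurations on a finite set [V] of sites have type [{ffun V -> X}];
   configurations on the whole lattice are plain functions. *)
Definition restriction V (w : 'rV[int]_d -> X) : {ffun V -> X} :=
  [ffun s : V => w (val s)].

Definition cylinders : set (set ('rV[int]_d -> X)) :=
  [set A | exists V (B : set {ffun V -> X}), A = restriction V @^-1` B].

(* On a site of [S `&` T] the value is that of [x], and [point] is never
   reached; the operation is only meaningful for disjoint [S] and [T]. *)
Definition concatenation S T (x : {ffun S -> X}) (y : {ffun T -> X}) :
    {ffun S `|` T -> X} :=
  [ffun s : S `|` T =>
    if insub (val s) : option S is Some u then x u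
    else if insub (val s) : option T is Some v then y v
    else (point : X)].

End random_fields.

Arguments cylinders {R} d X.

Definition configuration (R : realType) (d : nat) (X : state_space R) :=
  g_sigma_algebraType (cylinders d X).

Section palm.
Context {R : realType} {d : nat} {X : state_space R}.
Variable P : probability (configuration d X) R.

(* Probabilities are finite, so [fine] loses nothing. *)
Definition marginal (V : {fset 'rV[int]_d}) (x : {ffun V -> X}) : R :=
  fine (P (restriction V @^-1` [set x])).

Definition positive_field : Prop :=
  forall (V : {fset 'rV[int]_d}) (x : {ffun V -> X}), 0 < marginal x.

(* The Palm distribution is the family of these values for [t \notin V]. *)
Definition palm (V : {fset 'rV[int]_d}) (t : 'rV[int]_d)
    (z : {ffun [fset t] -> X}) (x : {ffun V -> X}) : R :=
  marginal (concatenation x z) / marginal z.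

End palm.

(* Main.v *)
Require Import Defs.
From HB Require Import structures.
From mathcomp Require Import all_boot all_order all_algebra finmap.
From mathcomp Require Import all_classical all_reals all_analysis.
Import Order.TTheory GRing.Theory Num.Theory.

(** A random field is determined by its finite-dimensional marginals, so it is
    enough to recover these from the Palm distribution. A marginal on a set
    [V] containing [t] is the product of a Palm probability given the value at
    [t] and the one-site marginal at [t]; thus everything reduces to one-site
    marginals.

    For those, let [P] and [P'] have the same Palm distribution, and take
    configurations [x] and [z] at two distinct sites [s] and [t], which exist
    because [1 <= d]. Write [m] and [m'] for the marginals. Conditioning the
    pair on [z] gives [m'(xz) / m(xz) = m'(z) / m(z)], and conditioning it on
    [x] gives [m'(xz) / m(xz) = m'(x) / m(x)]; all these numbers are nonzero by
    positivity. Hence [m(x) m'(z) = m'(x) m(z)]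
    ([one_site_ratio_constant]), and since [m] and [m'] both have total mass
    [1] at [s], summing over [x] yields [m'(z) = m(z)]
    ([one_site_marginal_eq]). Agreement then passes to all marginals
    ([marginal_eq]) and, by uniqueness of a finite measure on a generating
    class stable under intersection, to all measurable sets
    ([random_field_ext]). *)

#[local] Open Scope classical_set_scope.
#[local] Open Scope fset_scope.
#[local] Open Scope ring_scope.

Section cylinders.
Context {R : realType} {d : nat} {X : state_space R}.
Implicit Types (V S T : {fset 'rV[int]_d}) (w : 'rV[int]_d -> X).

Lemma restriction_eqP V w (x : {ffun V -> X}) :
  restriction V w = x <-> forall s (sV : s \in V), w s = x [` sV].
Proof.
split=> [<- s sV|wx]; first by rewrite ffunE.
by apply/ffunP => -[s sV]; rewrite ffunE wx.
Qed.

Lemma restriction_concatenation S T w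
    (x : {ffun S -> X}) (z : {ffun T -> X}) : [disjoint S & T] ->
  restriction (S `|` T) w = concatenation x z <->
  restriction S w = x /\ restriction T w = z.
Proof.
move=> ST.
have concl s (sS : s \in S) (sST : s \in S `|` T) :
    concatenation x z [` sST] = x [` sS].
  by rewrite ffunE /= insubT.
have concr s (sT : s \in T) (sST : s \in S `|` T) :
    concatenation x z [` sST] = z [` sT].
  rewrite ffunE /= insubF ?insubT //.
  by apply: contraTF sT => sS; apply: (fdisjointP ST).
split=> [/restriction_eqP wxz|[/restriction_eqP wx /restriction_eqP wz]].
  split; apply/restriction_eqP => s.
    by move=> sS; rewrite -(concl s sS) -?wxz // inE sS.
  by move=> sT; rewrite -(concr s sT) -?wxz // inE sT orbT.
apply/restriction_eqP => s sST; have := sST; rewrite in_fsetU => /orP[sS|sT].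
  by rewrite (concl s sS) wx.
by rewrite (concr s sT) wz.
Qed.

Lemma cylinder_concatenation S T (x : {ffun S -> X}) (z : {ffun T -> X}) :
  [disjoint S & T] ->
  restriction (S `|` T) @^-1` [set concatenation x z] =
  (restriction S @^-1` [set x] `&` restriction T @^-1` [set z])%classic.
Proof.
by move=> ST; apply/seteqP; split=> w /=; rewrite restriction_concatenation.
Qed.

Lemma concatenation_restriction S T w : [disjoint S & T] ->
  restriction (S `|` T) w = concatenation (restriction S w) (restriction T w).
Proof. by move=> ST; apply/restriction_concatenation. Qed.

Lemma measurable_cylinder V (B : set {ffun V -> X}) :
  measurable (restriction V @^-1` B : set (configuration d X)).
Proof. by apply: sub_sigma_algebra; exists V, B. Qed.

Lemma restriction_agree V T w w' : V `<=` T ->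
  restriction T w = restriction T w' -> restriction V w = restriction V w'.
Proof.
move=> VT /restriction_eqP ww'; apply/restriction_eqP => s sV.
by rewrite (ww' s (fsubsetP VT s sV)) !ffunE.
Qed.

(** Two cylinders with bases [V] and [T] both have a base on [V `|` T], since
    the restriction to the union determines both restrictions. *)
Lemma setI_closed_cylinders : setI_closed (cylinders d X).
Proof.
move=> _ _ [V [A ->]] [T [B ->]]; pose U := V `|` T.
exists U, (restriction U @`
  (restriction V @^-1` A `&` restriction T @^-1` B))%classic.
apply/seteqP; split=> [w|w] /=; first by exists w.
move=> [w' [Aw' Bw'] ww'].
by rewrite -(restriction_agree _ _ _ _ (fsubsetUl V T) ww')
           -(restriction_agree _ _ _ _ (fsubsetUr V T) ww').
Qed.

End cylinders.

Section marginals.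
Context {R : realType} {d : nat} {X : state_space R}.
Implicit Types (P : probability (configuration d X) R).
Implicit Types (V S T : {fset 'rV[int]_d}).

(** A cylinder over [V] is the disjoint union of the cylinders over the finitely
    many configurations in its base, so marginals determine its probability. *)
Lemma probability_cylinder P V (B : set {ffun V -> X}) :
  P (restriction V @^-1` B) = (\sum_(x \in B) marginal P x)%:E.
Proof.
rewrite -[in LHS](image_id B) -bigcup_imset1 preimage_bigcup measure_fin_bigcup.
- rewrite -fsumEFin; last exact: finite_finset.
  apply: eq_fsbigr => x _.
  by rewrite fineK // fin_num_measure //; apply: measurable_cylinder.
- exact: finite_finset.
- exact: trivIset_preimage1.
- by move=> x _; apply: measurable_cylinder.
Qed.

Lemma sum_marginal P V :
  \sum_(x \in [set: {ffun V -> X}]) marginal P x = 1.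
Proof.
by apply: EFin_inj; rewrite -probability_cylinder preimage_setT probability_setT.
Qed.

(** The two concatenations live on [S `|` T] and [T `|` S], hence in different
    types, but they define the same event. This symmetry is what lets a joint
    marginal be conditioned on either of its two parts. *)
Lemma marginal_concatenationC P S T
    (x : {ffun S -> X}) (z : {ffun T -> X}) : [disjoint S & T] ->
  marginal P (concatenation x z) = marginal P (concatenation z x).
Proof.
move=> ST; rewrite /marginal !cylinder_concatenation //; last first.
  by rewrite fdisjoint_sym.
by rewrite setIC.
Qed.

(** Cylinders generate the sigma-algebra and are stable under intersection, so
    the uniqueness theorem for finite measures applies. *)
Lemma random_field_ext P P' :
  (forall V (x : {ffun V -> X}), marginal P x = marginal P' x) ->
  forall A : set (configuration d X), measurable A -> P A = P' A.
Proof.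
move=> PP'; pose G : set (set (configuration d X)) := cylinders d X.
apply: (measure_unique G (fun=> setT) erefl _ _ _ P P') => //.
- exact: setI_closed_cylinders.
- by exists fset0, setT; rewrite preimage_setT.
- by rewrite bigcup_const.
- move=> _ [V [B ->]].
  apply: (etrans (probability_cylinder P V B)).
  apply: (etrans _ (esym (probability_cylinder P' V B))).
  by congr EFin; apply: eq_fsbigr => x _; exact: PP'.
- by move=> _; rewrite -ge0_fin_numE // fin_num_measure.
Qed.

End marginals.

Lemma ex_distinct_site d (t : 'rV[int]_d) : (1 <= d)%N ->
  exists s : 'rV[int]_d, s != t.
Proof.
case: d t => // d t _; exists (t + const_mx 1).
rewrite -subr_eq0 addrAC subrr add0r.
by apply/eqP => /matrixP/(_ 0 0); rewrite !mxE.
Qed.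

Section palm_recovery.
Context {R : realType} {d : nat} {X : state_space R}.
Context (P P' : probability (configuration d X) R)
  (P_pos : positive_field P) (P'_pos : positive_field P')
  (same_palm : forall (V : {fset 'rV[int]_d}) (t : 'rV[int]_d),
    t \notin V -> forall (z : {ffun [fset t] -> X}) (x : {ffun V -> X}),
    palm P z x = palm P' z x).

Let marginal_neq0 (V : {fset 'rV[int]_d}) (x : {ffun V -> X}) :
  marginal P x != 0.
Proof. exact: lt0r_neq0. Qed.

Let marginal'_neq0 (V : {fset 'rV[int]_d}) (x : {ffun V -> X}) :
  marginal P' x != 0.
Proof. exact: lt0r_neq0. Qed.

(** The joint marginal of [x] and [z] is computed from the Palm distribution in
    two ways, conditioning on [z] or on [x]. Hence
    [marginal P' z / marginal P z] and [marginal P' x / marginal P x] both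
    equal the ratio of the two joint marginals; the identity is the
    cross-multiplied form. *)
Lemma one_site_ratio_constant (s t : 'rV[int]_d)
    (x : {ffun [fset s] -> X}) (z : {ffun [fset t] -> X}) : s != t ->
  marginal P x * marginal P' z = marginal P' x * marginal P z.
Proof.
move=> st.
have st0 : [disjoint [fset s] & [fset t]] by rewrite fdisjoint1X inE.
have /same_palm/(_ z x) : t \notin [fset s] by rewrite inE eq_sym.
have /same_palm/(_ x z) : s \notin [fset t] by rewrite inE.
(* Over a common order of concatenation, both hypotheses involve only the two
   numbers [marginal P (concatenation z x)] and
   [marginal P' (concatenation z x)]. *)
rewrite /palm !(marginal_concatenationC _ _ _ _ _ st0).
move=> /eqP; rewrite eqr_div // => /eqP ex /eqP; rewrite eqr_div // => /eqP ez.
apply: (mulfI (marginal_neq0 _ (concatenation z x))).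
by rewrite mulrCA ez mulrCA mulrA -ex mulrA.
Qed.

(** Summing the previous identity over all [x] at a second site [s] makes both
    factors at [s] equal to [1]. *)
Lemma one_site_marginal_eq (t : 'rV[int]_d) (z : {ffun [fset t] -> X}) :
  (1 <= d)%N -> marginal P z = marginal P' z.
Proof.
move=> /(ex_distinct_site _ t)[s st].
rewrite -[LHS]mul1r -(sum_marginal P' [fset s]) mulr_fsuml.
under eq_fsbigr do rewrite -one_site_ratio_constant //.
by rewrite -mulr_fsuml sum_marginal mul1r.
Qed.

(** For [t] in [V], the marginal on [V] is a Palm probability given the value
    at [t] times the marginal at [t]; both factors are already known to agree.
    The empty [V] has no such [t], but its only cylinder is the whole space. *)
Lemma marginal_eq (V : {fset 'rV[int]_d}) (x : {ffun V -> X}) :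
  (1 <= d)%N -> marginal P x = marginal P' x.
Proof.
(* As the restriction of a global [w], the configuration can follow a change
   of the expression denoting [V] without any cast. *)
move=> hd; have [w <-] : exists w, restriction V w = x.
  exists (fun s => if insub s : option V is Some u then x u else point).
  by apply/restriction_eqP => s sV; rewrite insubT.
have [->|[t tV]] := fset_0Vmem V.
  rewrite /marginal (_ : _ @^-1` _ = setT) ?probability_setT //.
  apply/seteqP; split=> // w' _.
  by apply/restriction_eqP => s s0; have := s0; rewrite inE.
have tVt : t \notin V `\ t by rewrite !inE eqxx.
rewrite -(fsetD1K tV) fsetUC concatenation_restriction; last first.
  by rewrite fdisjointX1.
set y := restriction (_ `\ _) w; set z := restriction _ w.
apply: (mulIf (invr_neq0 (marginal_neq0 _ z))).
by rewrite [in RHS](one_site_marginal_eq _ _ hd); exact: same_palm.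
Qed.
End palm_recovery.

Theorem theorem8 (R : realType) (d : nat) (hd : (1 <= d)%N)
    (X : state_space R) (P P' : probability (configuration d X) R)
    (P_pos : positive_field P) (P'_pos : positive_field P')
    (same_palm : forall (V : {fset 'rV[int]_d}) (t : 'rV[int]_d),
       t \notin V ->
       forall (z : {ffun [fset t] -> X}) (x : {ffun V -> X}),
         palm P z x = palm P' z x) :
  forall A : set (configuration d X), measurable A -> P A = P' A.
Proof.
by apply: random_field_ext => V x; exact: marginal_eq.
Qed.
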